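(* Let $\lambda\in\mathbb{R}$. For all $k,l\in\mathbb{Z}$ with $k\ge l\ge 0$, $$S_{1,\lambda}(k,l)=\sum_{p=l}^{k}S_{1,\lambda}(k+1,p+1)\binom{p}{l}(1-\lambda)_{p-l,\lambda}.$$
   Context: For $\lambda\in\mathbb{R}$, the generalized falling factorials are $(x)_{0,\lambda}=1$, $(x)_{n,\lambda}=x(x-\lambda)\cdots(x-(n-1)\lambda)$ for $n\ge 1$, and the ordinary falling factorials are $(x)_{0}=1$, $(x)_{n}=x(x-1)\cdots(x-n+1)$ for $n\ge 1$. The degenerate Stirling numbers of the first kind $S_{1,\lambda}(n,k)$, $0\le k\le n$, are defined by the polynomial identity $(x)_{n}=\sum_{k=0}^{n}S_{1,\lambda}(n,k)(x)_{k,\lambda}$ for $n\ge 0$. *)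

(* Defs.v *)
From HB Require Import structures.
From mathcomp Require Import all_boot all_order all_algebra.
From mathcomp Require Import reals.

Set Implicit Arguments.
Unset Strict Implicit.
Unset Printing Implicit Defensive.

Import GRing.Theory.

Local Open Scope ring_scope.

Definition gffact (A : comNzRingType) (lam x : A) (n : nat) : A :=
  \prod_(i < n) (x - i%:R * lam).

(* ssrnat's n ^_ m only takes a natural number base. *)
Definition rffact (A : comNzRingType) (x : A) (n : nat) : A :=
  \prod_(i < n) (x - i%:R).

(* The defining identity in the ring of polynomials: it determines S n k for
   k <= n and leaves S n k unconstrained for k > n. *)
Definition is_degenerate_stirling1 (R : realType) (lam : R)
    (S : nat -> nat -> R) : Prop :=
  forall n : nat,
    rffact ('X : {poly R}) n =
    \sum_(k < n.+1) S n k *: gffact lam%:P ('X : {poly R}) k.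

Lemma gffact_size_monic (R : realType) (lam : R) (n : nat) :
  size (gffact lam%:P ('X : {poly R}) n) = n.+1 /\
  gffact lam%:P ('X : {poly R}) n \is monic.
Proof.
have E : gffact lam%:P ('X : {poly R}) n =
    \prod_(i <- enum 'I_n) ('X - (i%:R * lam)%:P).
  rewrite /gffact big_enum; apply: eq_bigr => i _.
  by rewrite polyCM polyC_natr.
by rewrite E size_prod_XsubC size_enum_ord monic_prod_XsubC.
Qed.

Lemma degenerate_stirling1_exists (R : realType) (lam : R) :
  exists S : nat -> nat -> R, is_degenerate_stirling1 lam S.
Proof.
suff H (n : nat) : exists c : nat -> R, rffact ('X : {poly R}) n =
    \sum_(k < n.+1) c k *: gffact lam%:P ('X : {poly R}) k.
  have [S HS] := boolp.choice H.
  by exists S.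
elim: n => [|n [c IH]].
  exists (fun=> 1).
  by rewrite big_ord1 /rffact /gffact !big_ord0 scale1r.
exists (fun k => (if k is j.+1 then c j else 0) +
                 (if (k <= n)%N then c k * (k%:R * lam - n%:R) else 0)).
rewrite /rffact big_ord_recr /= -/(rffact _ n) IH mulr_suml.
under [RHS]eq_bigr do rewrite scalerDl.
rewrite big_split /= [X in _ = X + _]big_ord_recl /= scale0r add0r.
rewrite [X in _ = _ + X]big_ord_recr /= ltnn scale0r addr0 -big_split /=.
apply: eq_bigr => i _.
rewrite -ltnS ltn_ord {2}/gffact big_ord_recr /= -/(gffact _ _ i).
rewrite -scalerA -scalerDr -scalerAl; congr (_ *: _).
rewrite -mul_polyC polyCB polyCM !polyC_natr [X in _ = _ + X]mulrC -mulrDr.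
by rewrite addrA subrK.
Qed.

Lemma degenerate_stirling1_unique (R : realType) (lam : R)
    (S T : nat -> nat -> R) (n k : nat) :
  is_degenerate_stirling1 lam S -> is_degenerate_stirling1 lam T ->
  (k <= n)%N -> S n k = T n k.
Proof.
move=> /(_ n) HS /(_ n); rewrite HS => /eqP; rewrite -subr_eq0 -sumrB => /eqP.
under eq_bigr do rewrite -scalerBl.
rewrite -ltnS => + kn; elim: n.+1 k kn => // m IH k km {HS}.
rewrite big_ord_recr /= => E.
have [sz mon] := gffact_size_monic lam m.
have Em : S n m - T n m = 0.
  have := congr1 (coefp m) E; rewrite /= coefD coef_sum big1 => [|i _].
    rewrite add0r coefZ coef0.
    by move/monicP: mon; rewrite /lead_coef sz /= => ->; rewrite mulr1.
  rewrite coefZ nth_default ?mulr0 //.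
  by have [-> _] := gffact_size_monic lam i.
move: km; rewrite ltnS leq_eqVlt => /orP[/eqP->|km].
  by apply/eqP; rewrite -subr_eq0 Em.
by apply: IH => //; move: E; rewrite Em scale0r addr0.
Qed.

(* Main.v *)
Require Import Defs.
From mathcomp Require Import all_boot all_order all_algebra.
From mathcomp Require Import reals.
From mathcomp Require Import ring.

(** The right-hand side is recognised as the coefficient of an expansion of
    [(x)_k] in the basis of generalized falling factorials, and coefficients
    in that basis are unique. The expansion comes from removing the first
    factor on both sides of the expansion of [(x + 1)_(k+1)]:
      - the left-hand side is [(x + 1) (x)_k];
      - on the right, [(x + 1)_(p+1,lam) = (x + 1) (x + 1 - lam)_(p,lam)], and
        the term without the factor [x + 1] has coefficient
        [S1 (k+1) 0 = 0] ([stirling1_col0]).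
    Cancelling [x + 1] gives
      [(x)_k = \sum_p S1 (k+1) (p+1) (x + (1 - lam))_(p,lam)]
    ([rffact_shift_expansion]), and the binomial theorem for generalized
    falling factorials ([gffactD]) splits [(x + (1 - lam))_(p,lam)] into the
    [(x)_(l,lam)] with coefficients ['C(p, l) (1 - lam)_(p-l,lam)]. *)

Set Implicit Arguments.
Unset Strict Implicit.
Unset Printing Implicit Defensive.

Import GRing.Theory.

Local Open Scope ring_scope.

(** Ordinary falling factorials are the case [lam = 1], so that the lemmas
    on [gffact] cover both families. *)
Lemma rffactE (A : comNzRingType) (x : A) (n : nat) :
  rffact x n = gffact 1 x n.
Proof. by apply: eq_bigr => i _; rewrite mulr1. Qed.

Lemma gffactSr (A : comNzRingType) (lam x : A) (n : nat) :
  gffact lam x n.+1 = gffact lam x n * (x - n%:R * lam).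
Proof. by rewrite /gffact big_ord_recr. Qed.

Lemma gffactSl (A : comNzRingType) (lam x : A) (n : nat) :
  gffact lam x n.+1 = x * gffact lam (x - lam) n.
Proof.
rewrite /gffact big_ord_recl mul0r subr0; congr (_ * _).
by apply: eq_bigr => i _; rewrite lift0 -natr1; ring.
Qed.

Lemma rmorph_gffact (A B : comNzRingType) (f : {rmorphism A -> B})
    (lam x : A) (n : nat) :
  f (gffact lam x n) = gffact (f lam) (f x) n.
Proof.
rewrite /gffact rmorph_prod; apply: eq_bigr => i _.
by rewrite rmorphB rmorphM rmorph_nat.
Qed.

(** Binomial theorem for generalized falling factorials. The induction step is
    Pascal's rule, because the new factor splits as
    [x + y - n lam = (x - i lam) + (y - (n - i) lam)], whose two parts extend
    the two factors of the [i]-th term. *)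
Lemma gffactD (A : comNzRingType) (lam x y : A) (n : nat) :
  gffact lam (x + y) n =
  \sum_(i < n.+1) 'C(n, i)%:R * gffact lam x i * gffact lam y (n - i).
Proof.
elim: n => [|n IH].
  by rewrite big_ord1 /gffact !big_ord0 !mulr1.
have step : gffact lam (x + y) n.+1 =
    \sum_(i < n.+1) 'C(n, i)%:R * gffact lam x i.+1 * gffact lam y (n - i) +
    \sum_(i < n.+1) 'C(n, i)%:R * gffact lam x i * gffact lam y (n.+1 - i).
  rewrite gffactSr IH mulr_suml -big_split /=; apply: eq_bigr => i _.
  have le_in : (i <= n)%N by rewrite -ltnS.
  rewrite subSn // !gffactSr natrB //; ring.
rewrite step [RHS]big_ord_recl /=.
under [X in _ = _ + X]eq_bigr => i _ do
  rewrite /bump add1n binS addnC natrD subSS 2!mulrDl.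
rewrite big_split /= addrCA; congr (_ + _).
rewrite big_ord_recl [in RHS]big_ord_recr /= !bin0 bin_small // mul0r mul0r.
by rewrite addr0.
Qed.

(** Both families of factorials of positive index vanish at [0], so evaluating
    the defining identity there isolates the constant coefficient. *)
Lemma stirling1_col0 (R : realType) (lam : R) (S : nat -> nat -> R) (n : nat) :
  is_degenerate_stirling1 lam S -> S n.+1 0%N = 0.
Proof.
move=> /(_ n.+1) /(congr1 (horner_eval 0)).
rewrite big_ord_recl /= rffactE gffactSl /gffact big_ord0 alg_polyC.
rewrite /horner_eval hornerM hornerX mul0r hornerD hornerC horner_sum.
rewrite big1 => [|i _]; first by rewrite addr0.
rewrite /bump add1n -/(gffact _ _ _) gffactSl.
by rewrite hornerZ hornerM hornerX mul0r mulr0.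
Qed.

Lemma rffact_shift_expansion (R : realType) (lam : R) (S : nat -> nat -> R)
    (n : nat) : is_degenerate_stirling1 lam S ->
  rffact ('X : {poly R}) n =
  \sum_(p < n.+1) S n.+1 p.+1 *: gffact lam%:P ('X + (1 - lam)%:P) p.
Proof.
move=> HS; have := congr1 (comp_poly ('X + 1)) (HS n.+1).
rewrite big_ord_recl (stirling1_col0 n HS) scale0r add0r !rffactE.
rewrite rmorph_gffact rmorph1 rmorph_sum /= comp_polyX gffactSl addrK => E.
have X1_neq0 : 'X + 1 != 0 :> {poly R} by rewrite -size_poly_eq0 size_XaddC.
apply: (mulfI X1_neq0); rewrite E mulr_sumr; apply: eq_bigr => i _.
rewrite /bump add1n comp_polyZ rmorph_gffact /= comp_polyX comp_polyC gffactSl.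
by rewrite scalerAr polyCB addrA.
Qed.

Theorem theorem6 (R : realType) (lam : R) (S1 : nat -> nat -> R)
    (hS1 : is_degenerate_stirling1 lam S1) (k l : nat) (hlk : (l <= k)%N) :
  S1 k l =
  \sum_(l <= p < k.+1)
    S1 k.+1 p.+1 * 'C(p, l)%:R * gffact lam (1 - lam) (p - l).
Proof.
pose T n j : R := \sum_(j <= p < n.+1)
  S1 n.+1 p.+1 * 'C(p, j)%:R * gffact lam (1 - lam) (p - j).
suff hT : is_degenerate_stirling1 lam T.
  exact: (degenerate_stirling1_unique hS1 hT hlk).
move=> n; rewrite (rffact_shift_expansion n hS1).
(* The binomial coefficient vanishes for p < j, so both sums can range over
   the whole square p, j <= n, where they can be exchanged. *)
have TE j : (j < n.+1)%N -> T n j = \sum_(p < n.+1)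
    S1 n.+1 p.+1 * 'C(p, j)%:R * gffact lam (1 - lam) (p - j).
  move=> lt_jn; rewrite -(big_mkord xpredT
    (fun p => S1 n.+1 p.+1 * 'C(p, j)%:R * gffact lam (1 - lam) (p - j))).
  rewrite (big_cat_nat (leq0n j) (ltnW lt_jn)) /= big_nat big1 ?add0r //.
  by move=> p /andP[_ lt_pj]; rewrite bin_small // mulr0 mul0r.
have DE p : (p < n.+1)%N -> gffact lam%:P ('X + (1 - lam)%:P) p =
    \sum_(j < n.+1) ('C(p, j)%:R * gffact lam (1 - lam) (p - j)) *:
      gffact lam%:P ('X : {poly R}) j.
  move=> lt_pn; rewrite gffactD.
  pose F j := 'C(p, j)%:R * gffact lam%:P ('X : {poly R}) j *
    gffact lam%:P (1 - lam)%:P (p - j).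
  rewrite (big_ord_widen _ F lt_pn) big_mkcond /=; apply: eq_bigr => j _.
  rewrite ltnS; case: leqP => [_|lt_pj].
    rewrite /F -rmorph_gffact -mul_polyC polyCM polyC_natr; ring.
  by rewrite bin_small // mul0r scale0r.
under eq_bigr => p _ do rewrite DE // scaler_sumr.
rewrite exchange_big /=; apply: eq_bigr => j _.
rewrite TE // scaler_suml; apply: eq_bigr => p _.
by rewrite scalerA mulrA.
Qed.
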